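(* Let $M=(m_{i,j})_{i,j\in\mathbb{Z}_+}$ be an arbitrary complex semi-infinite symmetric (respectively, skew-symmetric) matrix whose columns belong to $\ell^2$. Then there exist a separable complex Hilbert space $H$, a conjugation $J$ in $H$, a J-symmetric (respectively, J-skew-symmetric) operator $A$ in $H$, and an orthonormal basis $\mathcal F=\{f_k\}_{k\in\mathbb{Z}_+}$ in $H$ corresponding to $J$ with $\mathcal F\subset D(A)$, such that $M$ is the matrix of $A$ in the basis $\mathcal F$, i.e. $m_{i,j}=(Af_j,f_i)$ for all $i,j\in\mathbb{Z}_+$, and $\mathcal F$ is a basis of the matrix representation for $A$.
   Context: $\mathbb{Z}_+$ is the set of non-negative integers. Linear operators $A$ in $H$ are possibly unbounded, defined on a linear subspace $D(A)\subseteq H$. The scalar product $(\cdot,\cdot)$ is linear in the first argument. Symmetric means $m_{i,j}=m_{j,i}$, skew-symmetric means $m_{i,j}=-m_{j,i}$. A conjugation in $H$ is a map $J:H\to H$ with $J^2=E$ (the identity) and $(Jx,Jy)=\overline{(x,y)}$ for all $x,y\in H$. An orthonormal basis $\{f_k\}_{k\in\mathbb{Z}_+}$ of $H$ corresponds to $J$ if $Jx=\sum_{k}\overline{x_k}f_k$ for every $x=\sum_kx_kf_k\in H$. The J-form is $[x,y]_J:=(x,Jy)$. A linear operator $A$ is J-symmetric if $[Ax,y]_J=[x,Ay]_J$ for all $x,y\in D(A)$, and J-skew-symmetric if $[Ax,y]_J=-[x,Ay]_J$ for all $x,y\in D(A)$. Let $A$ be a closed J-symmetric (or J-skew-symmetric)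 operator with $\mathcal F\subset D(A)$, $\mathcal F$ corresponding to $J$. Let $T$ be the operator with domain the (algebraic) linear span of $\mathcal F$ acting by matrix multiplication by $(a_{i,j})$, $a_{i,j}=(Af_j,f_i)$ (i.e. $Tf_j=\sum_ia_{i,j}f_i$); $T$ is closable. $\mathcal F$ is called a basis of the matrix representation for $A$ if $A=\overline{T}$, the closure of $T$. *)

(* Defs.v *)
From HB Require Import structures.
From mathcomp Require Import all_boot all_order all_algebra.
From mathcomp Require Import complex.
From mathcomp Require Import all_classical all_reals all_analysis.

Set Implicit Arguments.
Unset Strict Implicit.
Unset Printing Implicit Defensive.

Import Order.TTheory GRing.Theory Num.Theory Num.Def.
Import numFieldNormedType.Exports.

Local Open Scope classical_set_scope.
Local Open Scope complex_scope.
Local Open Scope ring_scope.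

(* [{dot H for conjC}] is linear in its first argument and conjugate-linear in
   the second.  The norm of a normed module over [R[i]] is [R[i]]-valued. *)
Record hilbertSpace (R : realType) := HilbertSpace {
  hilbert_sort :> completeNormedModType R[i];
  inner : {dot hilbert_sort for conjC};
  inner_norm : forall x : hilbert_sort, `|x| ^+ 2 = inner x x
}.

(* The values of [op] outside [dom] are irrelevant: operators are compared
   through their graphs. *)
Record operator (R : realType) (H : hilbertSpace R) := Operator {
  dom : set H;
  op : H -> H;
  dom0 : dom 0;
  domP : forall (c : R[i]) (x y : H), dom x -> dom y -> dom (c *: x + y);
  opP : forall (c : R[i]) (x y : H), dom x -> dom y ->
    op (c *: x + y) = c *: op x + op y
}.

Section Hilbert.
Context (R : realType) (H : hilbertSpace R).
Implicit Types (x y : H) (f : nat -> H) (J : H -> H) (A T : operator H).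

Local Notation "'[ x , y ]" := (inner H x y).

Definition separable := exists2 D : set H, countable D & dense D.

Definition conjugation J :=
  (forall x, J (J x) = x) /\ (forall x y, '[J x, J y] = conjC '[x, y]).

Definition orthonormal f := forall j k, '[f j, f k] = (j == k)%:R.

Definition orthonormal_basis f :=
  orthonormal f /\
  (forall x, exists c : nat -> R[i], series (fun k => c k *: f k) @ \oo --> x).

Definition corresponds f J := forall x (c : nat -> R[i]),
  series (fun k => c k *: f k) @ \oo --> x ->
  series (fun k => conjC (c k) *: f k) @ \oo --> J x.

Definition Jform J x y : R[i] := '[x, J y].

Definition J_symmetric J A := forall x y, dom A x -> dom A y ->
  Jform J (op A x) y = Jform J x (op A y).

Definition J_skew_symmetric J A := forall x y, dom A x -> dom A y ->
  Jform J (op A x) y = - Jform J x (op A y).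

Definition graph A : set (H * H) :=
  [set p | dom A p.1 /\ p.2 = op A p.1].

Definition closed_operator A := closed (graph A).

Definition is_operator_closure A T := graph A = closure (graph T).

Definition matrix_of A f (i j : nat) : R[i] := '[op A (f j), f i].

Definition lin_span f : set H :=
  [set x | exists n (c : nat -> R[i]), x = \sum_(k < n) c k *: f k].

(* By linearity these two conditions determine [T], up to the irrelevant
   values outside its domain. *)
Definition is_matrix_operator f (a : nat -> nat -> R[i]) T :=
  dom T = lin_span f /\
  (forall j, series (fun i => a i j *: f i) @ \oo --> op T (f j)).

Definition matrix_repr_basis A f :=
  closed_operator A /\
  exists2 T, is_matrix_operator f (matrix_of A f) T & is_operator_closure A T.

End Hilbert.

Definition square_summable (R : realType) (u : nat -> R[i]) :=
  cvgn (series (fun i => Normc.normc (u i) ^+ 2)).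

(* Main.v *)
Require Import Defs.
From HB Require Import structures.
From mathcomp Require Import all_boot all_order all_algebra.
From mathcomp Require Import complex.
From mathcomp Require Import all_classical all_reals all_analysis ring lra.
Set Implicit Arguments.
Unset Strict Implicit.
Unset Printing Implicit Defensive.

Import Order.TTheory GRing.Theory Num.Theory Num.Def.
Import numFieldNormedType.Exports.

Local Open Scope classical_set_scope.
Local Open Scope complex_scope.
Local Open Scope ring_scope.

(** The operator is the closure of the matrix acting on finite sequences, and
    the Hilbert space is l2.

    On the linear span of an orthonormal basis [f] let [T] send [f j] to the
    vector [col j] with coordinates [M i j].  The vectors of [f] being fixed by
    the conjugation [J], the J-form of [col j] and [f i] is [M i j], and that of
    [f j] and [col i] is [M j i].  Hence the hypothesis
    [M i j = eps * M j i], with [eps] equal to 1 or -1, says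
    [T x, y]_J = eps [x, T y]_J for basis vectors.  This identity is linear
    and continuous in the pair [(x, T x)], and, the J-form being symmetric, also
    in [(y, T y)]; it therefore extends from the pairs [(f j, col j)] to the
    closure of their span in [H * H] ([Jform_closure_span]).

    The same identity makes [T] closable: if [(0, v)] is in that closure then
    [v] is orthogonal to every [f k], hence zero ([closure_span_single_valued]).  So the
    closure of the graph is the graph of an operator [A], which is J-symmetric
    or J-skew-symmetric, is closed, and is the closure of [T] by construction.
    The symmetric and the skew-symmetric case are the two values of [eps].

    What remains is the ambient space: the square summable sequences form a
    complete inner product space ([ell2_hilbert]), in which the columns of [M]
    are vectors, the unit sequences are an orthonormal basis
    ([ell2_delta_basis]) and entrywise conjugation fixes them.  A Hilbert space
    with such a basis is separable ([orthonormal_basis_separable]), and a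
    conjugation fixing the basis corresponds to it
    ([conjugation_corresponds]). *)

(** * Inner products and series *)

Section CauchySchwarz.
Context (C : numClosedFieldType) (U : lmodType C) (dot : {dot U for conjC}).
Implicit Types x y : U.

Lemma dot_CauchySchwarz x y : `|dot x y| ^+ 2 <= dot x x * dot y y.
Proof.
have [->|y0] := eqVneq y 0; first by rewrite !linear0r normr0 expr0n/= ?mulr0.
have yy_gt0 : 0 < dot y y by rewrite dnorm_gt0.
pose a := dot x y / dot y y.
have ay : dot (x - a *: y) y = 0.
  by rewrite linearBl linearZl_LR divfK ?subrr// gt_eqF.
have := dnorm_ge0 dot (x - a *: y).
rewrite [X in 0 <= X]linearBr linearZr_LR /= ay mulr0 subr0.
rewrite linearBl linearZl_LR/= subr_ge0.
rewrite [dot y x]hermC expr0 mul1r /a mulrAC -normCK ler_pdivrMr//.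
Qed.

Lemma dot_CauchySchwarz_sqrt x y :
  `|dot x y| <= sqrtC (dot x x) * sqrtC (dot y y).
Proof.
rewrite -(sqrCK (normr_ge0 _)) -sqrtCM ?nnegrE ?dnorm_ge0//.
by rewrite ler_sqrtC ?nnegrE ?mulr_ge0 ?dnorm_ge0 ?exprn_ge0 ?dot_CauchySchwarz.
Qed.

Lemma sqrt_dnormD x y :
  sqrtC (dot (x + y) (x + y)) <= sqrtC (dot x x) + sqrtC (dot y y).
Proof.
rewrite -[leRHS]sqrCK ?addr_ge0 ?sqrt_dnorm_ge0//.
rewrite ler_sqrtC ?nnegrE ?dnorm_ge0 ?exprn_ge0 ?addr_ge0 ?sqrt_dnorm_ge0//.
rewrite dnormD sqrrD !sqrtCK addrAC lerD2r lerD2l.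
have -> : dot x y + (dot x y)^* = 'Re (dot x y) *+ 2.
  by rewrite -mulr_natr ReE mulfVK// pnatr_eq0.
rewrite lerMn2r/=; apply: le_trans (dot_CauchySchwarz_sqrt x y).
exact: le_trans (real_ler_norm (Creal_Re _)) (leif_normC_Re_Creal _).1.
Qed.

End CauchySchwarz.

Lemma series_single (K : numFieldType) (V : normedModType K) (a : nat -> V) k :
  (forall j, j != k -> a j = 0) -> series a @ \oo --> a k.
Proof.
move=> a0; apply: cvg_near_cst; near=> n.
have kn : (k < n)%N by near: n; exists k.+1.
rewrite seriesEord/= (bigD1 (Ordinal kn))//= big1 ?addr0// => j jk.
by apply: a0; rewrite -val_eqE in jk.
Unshelve. all: by end_near. Qed.

Lemma gt0_complex (R : rcfType) (e : R[i]) : 0 < e ->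
  e = (complex.Re e)%:C /\ 0 < complex.Re e.
Proof. by case: e => x y; rewrite ltcE/= => /andP[/eqP -> ?]. Qed.

(** * Orthonormal bases and conjugations of a Hilbert space *)

Section HilbertTheory.
Context (R : realType) (H : hilbertSpace R).
Implicit Types (x y z : H) (f : nat -> H) (J : H -> H).

Local Notation "'[ x , y ]" := (inner H x y).

Lemma inner_CauchySchwarz x y : `|'[x, y]| <= `|x| * `|y|.
Proof.
apply: le_trans (dot_CauchySchwarz_sqrt _ _ _) _.
by rewrite -!inner_norm !sqrCK.
Qed.

Lemma inner_continuous y : continuous (fun x => '[x, y] : R[i]^o).
Proof.
move=> x; apply/cvgrPdist_lt => e e0; near=> z.
rewrite -linearBl/= (le_lt_trans (inner_CauchySchwarz _ _))//.
have y1 : 0 < `|y| + 1 by rewrite ltr_wpDl.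
rewrite (@le_lt_trans _ _ (`|x - z| * (`|y| + 1)))//.
  by rewrite ler_wpM2l// lerDl.
rewrite -ltr_pdivlMr//.
by near: z; apply: cvgr_dist_lt; rewrite ?divr_gt0.
Unshelve. all: by end_near. Qed.

(** With [g] and [h] the two projections of [H * H], this makes the J-form
    identity tested against a fixed vector a closed condition on a graph. *)
Lemma closed_inner_eq (U : topologicalType) (g h : U -> H) y z :
  continuous g -> continuous h ->
  closed [set p | '[g p, y] = '[h p, z]].
Proof.
move=> gc hc.
have -> : [set p | '[g p, y] = '[h p, z]] =
    (fun p => '[g p, y] - '[h p, z] : R[i]^o) @^-1` [set 0].
  by apply/seteqP; split=> p /=; [move=> ->; rewrite subrr|move/subr0_eq].
apply: preimage_closed; last exact/accessible_closed_set1/hausdorff_accessible/norm_hausdorff.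
move=> p _; apply: (@cvgB _ R[i]^o).
- apply: (@continuous_comp _ _ _ g (fun x => '[x, y] : R[i]^o)); first exact: gc.
  exact: inner_continuous.
- apply: (@continuous_comp _ _ _ h (fun x => '[x, z] : R[i]^o)); first exact: hc.
  exact: inner_continuous.
Qed.

Lemma orthonormal_coef f x (c : nat -> R[i]) k : Defs.orthonormal f ->
  series (fun k => c k *: f k) @ \oo --> x -> c k = '[x, f k].
Proof.
move=> fo cx.
have seriesE n : '[series (fun k => c k *: f k) n, f k] =
    series (fun j => c j * (j == k)%:R : R[i]^o) n.
  rewrite /series/= linear_sumlz/=; apply: eq_bigr => j _.
  by rewrite linearZl_LR/= fo.
have cxk := cvg_comp _ _ cx (@inner_continuous (f k) x).
have := cvg_lim (@norm_hausdorff _ R[i]^o) cxk; rewrite /comp/= => <-.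
rewrite (_ : (fun n => _) = series (fun j => c j * (j == k)%:R : R[i]^o)).
  apply/esym/(cvg_lim (@norm_hausdorff _ R[i]^o)).
  have := @series_single _ R[i]^o (fun j => c j * (j == k)%:R) k.
  by rewrite eqxx mulr1; apply=> j /negbTE ->; rewrite mulr0.
by apply/funext => n; rewrite /= seriesE.
Qed.

Lemma orthonormal_basis_expansion f x : orthonormal_basis f ->
  series (fun k => '[x, f k] *: f k) @ \oo --> x.
Proof.
move=> [fo /(_ x)[c cx]]; rewrite (_ : (fun k => _) = (fun k => c k *: f k))//.
by apply/funext => k; rewrite -(orthonormal_coef k fo cx).
Qed.

Lemma orthonormal_basis_eq f x y : orthonormal_basis f ->
  (forall k, '[x, f k] = '[y, f k]) -> x = y.
Proof.
move=> fb xy; have := orthonormal_basis_expansion (x := x) fb.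
under eq_fun do rewrite xy.
move/(cvg_lim (@norm_hausdorff _ _)) => <-.
exact/(cvg_lim (@norm_hausdorff _ _))/orthonormal_basis_expansion.
Qed.

(** The coefficients of [J x] can be read off directly, since
    [(J x, f k) = (J x, J (f k))] is the conjugate of [(x, f k)]. *)
Lemma conjugation_corresponds f J : orthonormal_basis f -> conjugation J ->
  (forall k, J (f k) = f k) -> corresponds f J.
Proof.
move=> fb [_ JJ] Jf x c cx.
have := orthonormal_basis_expansion (x := J x) fb.
rewrite (_ : (fun k => _) = (fun k => conjC (c k) *: f k))//.
apply/funext => k; rewrite -{1}(Jf k) JJ -(orthonormal_coef k fb.1 cx)//.
Qed.

Lemma JformC J x y : conjugation J -> Jform J x y = Jform J y x.
Proof.
move=> [JK JJ]; rewrite /Jform -{1}(JK x) JJ.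
by rewrite [RHS]hermC/= expr0 mul1r.
Qed.

End HilbertTheory.

Section Separability.
Context (R : realType).

Definition gauss_rat (q : rat * rat) : R[i] := ratr q.1 +i* ratr q.2.

Lemma dense_gauss_rat : dense (range gauss_rat : set R[i]^o).
Proof.
move=> O [z Oz] Oopen.
have /nbhs_ballP[e /= e0 zeO] : nbhs (z : R[i]^o) O by exact: open_nbhs_nbhs.
have [eE er0] := gt0_complex e0.
have approx (a : R) : exists q : rat, `|a - ratr q| < complex.Re e / 2.
  have ae : a - complex.Re e / 2 < a + complex.Re e / 2.
    by rewrite ltrD2l gtrN ?divr_gt0.
  have [q] := rat_in_itvoo ae.
  by rewrite in_itv/= => ?; exists q; rewrite ltr_distlC.
have [q1 zq1] := approx (complex.Re z); have [q2 zq2] := approx (complex.Im z).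
exists (gauss_rat (q1, q2)); split; last by exists (q1, q2).
apply: zeO; rewrite -ball_normE /ball_/=.
have -> : e = (complex.Re e / 2)%:C + (complex.Re e / 2)%:C.
  by rewrite -rmorphD/= -splitr.
have -> : z - gauss_rat (q1, q2) =
    (complex.Re z - ratr q1)%:C + (complex.Im z - ratr q2)%:C * 'i.
  by case: (z) => a b; rewrite /gauss_rat; simpc.
rewrite (le_lt_trans (ler_normD _ _))// ltrD//.
  by rewrite normc_def/= expr0n/= addr0 sqrtr_sqr ltcR.
by rewrite normrM !normc_def/= expr0n/= !addr0 add0r expr1n sqrtr1 mulr1 sqrtr_sqr ltcR.
Qed.

(** Finite combinations of the basis are dense, and so are those with Gaussian
    rational coefficients, of which there are countably many. *)
Lemma orthonormal_basis_separable (H : hilbertSpace R) (f : nat -> H) :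
  orthonormal_basis f -> separable H.
Proof.
move=> [_ fb].
pose comb (s : seq (rat * rat)) := \sum_(k < size s) gauss_rat (nth 0 s k) *: f k.
exists (range comb).
  by apply: (card_le_trans (card_image_le _ _)); exact: countableP.
move=> O [x Ox] Oopen.
have [c cx] := fb x.
have [n _ /(_ n (leqnn n)) /= On] : (\forall n \near \oo, O (series (fun k => c k *: f k) n)).
  by apply: cx; exact: open_nbhs_nbhs.
(* The coefficients become Gaussian rational one at a time: each replacement
   keeps the sum in the open set [O], the others being absorbed in [y]. *)
have step m (d : nat -> R[i]) y : O (\sum_(k < m) d k *: f k + y) ->
    exists s : seq (rat * rat), size s = m /\ O (comb s + y).
  elim: m y => [|m IH] y.
    by rewrite big_ord0 => Oy; exists [::]; rewrite /comb big_ord0.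
  rewrite big_ord_recr/= => Om.
  pose g (t : R[i]^o) := \sum_(k < m) d k *: f k + ((t : R[i]) *: f m + y).
  have gc : continuous g.
    move=> t; apply: (@cvgD _ H _ (nbhs (t : R[i]^o))); first exact: cvg_cst.
    apply: (@cvgD _ H _ (nbhs (t : R[i]^o))); last exact: cvg_cst.
    exact: scalel_continuous.
  have [||t [/= Ot [q _ qt]]] := @dense_gauss_rat (g @^-1` O).
  - by exists (d m); rewrite /= /g addrA.
  - by move/continuousP: gc; exact.
  rewrite -qt in Ot; have [s [sm Os]] := IH _ Ot.
  exists (rcons s q); rewrite size_rcons sm; split=> //.
  rewrite /comb size_rcons big_ord_recr/= nth_rcons ltnn eqxx -addrA sm.
  move: Os; rewrite /comb -sm; congr (O (_ + _)); apply: eq_bigr => k _.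
  by rewrite nth_rcons ltn_ord.
have [|s [_ Os]] := step n c 0; first by move: On; rewrite seriesEord addr0.
by exists (comb s); split; [rewrite -[comb s]addr0|exists s].
Qed.

End Separability.

(** * Linear relations and their closures *)

Section LinearRelations.
Context (R : realType).

Definition linear_subspace (V : lmodType R[i]) (G : set V) :=
  G 0 /\ forall c x y, G x -> G y -> G (c *: x + y).

(** Separate continuity of the operations is enough: [c *: x + y] is moved into
    the closure one argument at a time. *)
Lemma closure_linear_subspace (V : normedModType R[i]) (G : set V) :
  linear_subspace G -> linear_subspace (closure G).
Proof.
move=> [G0 Glin]; split; first exact: subset_closure.
have closure_stable (h : V -> V) (A B : set V) : continuous h ->
    (forall x, A x -> closure B (h x)) -> forall x, closure A x -> closure B (h x).
  move=> hc AB.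
  have : closure A `<=` h @^-1` closure B.
    rewrite closureE; apply: smallest_sub => //.
    by apply: preimage_closed => [x _|]; [exact: hc|exact: closed_closure].
  by move=> hAB x /hAB.
have addc (q : V) : continuous (fun p => p + q).
  by move=> p; apply: cvgD; [exact: cvg_id|exact: cvg_cst].
have addZc c : continuous (fun p : V => c *: p).
  by move=> p; apply: cvgZ; [exact: cvg_cst|exact: cvg_id].
move=> c x y Gx Gy.
have GZ : closure G (c *: x).
  apply: (closure_stable _ G) => // z Gz; apply: subset_closure.
  by rewrite -[_ *: _]addr0; exact: Glin.
have GD z : G z -> closure G (c *: x + z).
  move=> Gz; apply: (closure_stable (fun p => p + z) G) => // w Gw.
  by apply: subset_closure; rewrite -[w]scale1r; exact: Glin.
rewrite addrC; apply: (closure_stable (fun p => p + c *: x) G) => // z Gz.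
by rewrite addrC; exact: GD.
Qed.

Context (H : hilbertSpace R) (G : set (H * H)).
Hypothesis Glin : linear_subspace G.
Hypothesis Gfun : forall v, G (0, v) -> v = 0.

Lemma relation_single_valued x v w : G (x, v) -> G (x, w) -> v = w.
Proof.
move=> Gv Gw; apply/eqP; rewrite -subr_eq0; apply/eqP/Gfun.
have <- : (-1 *: x + x, -1 *: w + v) = (0, v - w).
  by rewrite !scaleN1r addNr addrC.
exact: (Glin.2 (-1) _ _ Gw Gv).
Qed.

Definition relation_dom : set H := [set x | exists v, G (x, v)].

Definition relation_op (x : H) : H := xget 0 [set v | G (x, v)].

Lemma relation_opE x v : G (x, v) -> relation_op x = v.
Proof.
move=> Gxv; apply: xget_unique => // w Gxw; exact: relation_single_valued Gxw Gxv.
Qed.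

Lemma relation_dom0 : relation_dom 0.
Proof. by exists 0; exact: Glin.1. Qed.

Lemma relation_domP (c : R[i]) x y :
  relation_dom x -> relation_dom y -> relation_dom (c *: x + y).
Proof.
by move=> [v Gv] [w Gw]; exists (c *: v + w); exact: (Glin.2 c _ _ Gv Gw).
Qed.

Lemma relation_opP (c : R[i]) x y : relation_dom x -> relation_dom y ->
  relation_op (c *: x + y) = c *: relation_op x + relation_op y.
Proof.
move=> [v Gv] [w Gw]; rewrite (relation_opE Gv) (relation_opE Gw).
by apply: relation_opE; exact: (Glin.2 c _ _ Gv Gw).
Qed.

(** The operator whose graph is the single-valued linear relation [G].  Both the
    matrix operator and its closure are obtained this way. *)
Definition relation_operator : operator H :=
  Operator relation_dom0 relation_domP relation_opP.

Lemma graph_relation_operator : graph relation_operator = G.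
Proof.
apply/seteqP; split=> [[x v] [/= [w Gw] ->]|[x v] Gxv].
  by rewrite (relation_opE Gw).
by split; [exists v|rewrite /= (relation_opE Gxv)].
Qed.

End LinearRelations.

Section SequenceSpan.
Context (R : realType) (V : lmodType R[i]).

Definition sequence_span (p : nat -> V) : set V :=
  [set q | exists n (c : nat -> R[i]), q = \sum_(k < n) c k *: p k].

Lemma sequence_span_linear p : linear_subspace (sequence_span p).
Proof.
split; first by exists 0%N, (fun=> 0); rewrite big_ord0.
move=> a _ _ [n [c ->]] [m [d ->]].
(* Combinations of different lengths are added after padding with zeros. *)
have pad k (e : nat -> R[i]) N : (k <= N)%N -> \sum_(i < k) e i *: p i =
    \sum_(i < N) (if (i < k)%N then e i else 0) *: p i.
  move=> kN; rewrite (big_ord_widen N (fun i => e i *: p i))// big_mkcond.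
  by apply: eq_bigr => i _; case: ifP; rewrite ?scale0r.
pose N := maxn n m.
rewrite (pad n c N) ?leq_maxl// (pad m d N) ?leq_maxr//.
exists N, (fun i => a * (if (i < n)%N then c i else 0) +
                    (if (i < m)%N then d i else 0)).
rewrite scaler_sumr -big_split/=; apply: eq_bigr => i _.
by rewrite scalerDl scalerA.
Qed.

Lemma sequence_span_mem p k : sequence_span p (p k).
Proof.
exists k.+1, (fun i => (i == k)%:R); rewrite big_ord_recr/= eqxx scale1r.
rewrite big1 ?add0r// => i _; rewrite ltn_eqF ?scale0r//.
Qed.

End SequenceSpan.

Section MatrixOperators.
Context (R : realType) (H : hilbertSpace R).

Lemma closure_span_inner_eq (V : normedModType R[i]) (p : nat -> V)
    (g h : {linear V -> H}) y z : continuous g -> continuous h ->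
  (forall k, inner H (g (p k)) y = inner H (h (p k)) z) ->
  forall q, closure (sequence_span p) q -> inner H (g q) y = inner H (h q) z.
Proof.
move=> gc hc pE.
suff : closure (sequence_span p) `<=` [set q | inner H (g q) y = inner H (h q) z].
  by [].
rewrite closureE; apply: smallest_sub; first exact: closed_inner_eq.
move=> _ [n [c ->]] /=; rewrite !linear_sum/= !linear_sumlz/=.
by apply: eq_bigr => k _; rewrite !linearZ/= !linearZl_LR/= pE.
Qed.

Variables (J : H -> H) (f col : nat -> H) (M : nat -> nat -> R[i]) (eps : R[i]).
Hypotheses (Jconj : conjugation J) (fbasis : orthonormal_basis f).
Hypothesis Jf : forall k, J (f k) = f k.
Hypothesis colE : forall i j, inner H (col j) (f i) = M i j.
Hypothesis MC : forall i j, M i j = eps * M j i.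

Let pair k : H * H := (f k, col k).
Let S : set (H * H) := sequence_span pair.

(** The identity holds on the generators by the symmetry of [M].  For a fixed
    second argument it cuts out a closed subspace of [H * H], so it extends in
    [p]; the symmetry of the J-form then lets the same argument run in [q]. *)
Lemma Jform_closure_span p q : closure S p -> closure S q ->
  Jform J p.2 q.1 = eps * Jform J p.1 q.2.
Proof.
have fstc : continuous (fst : H * H -> H) by move=> x; exact: cvg_fst.
have sndc : continuous (snd : H * H -> H) by move=> x; exact: cvg_snd.
have epsr x y : eps * inner H x y = inner H x (conjC eps *: y).
  by rewrite linearZr_LR/= conjCK.
move=> Sp; have pE k : Jform J p.2 (f k) = eps * Jform J p.1 (col k).
  rewrite /Jform epsr.
  apply: (closure_span_inner_eq (g := snd) (h := fst) sndc fstc _ Sp) => j /=.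
  rewrite -epsr Jf colE MC -colE; congr (_ * _).
  by rewrite -[RHS]/(Jform J _ _) JformC// /Jform Jf.
move=> Sq; rewrite JformC// [Jform J p.1 _]JformC// /Jform epsr.
apply: (closure_span_inner_eq (g := fst) (h := snd) fstc sndc _ Sq) => j /=.
by rewrite -epsr -!/(Jform J _ _) !(JformC _ p.2, JformC _ p.1) ?pE.
Qed.

(** Closability: against the generator [(f k, col k)] the identity reads
    [(v, f k) = eps * (0, J (col k)) = 0]. *)
Lemma closure_span_single_valued v : closure S (0, v) -> v = 0.
Proof.
move=> Sv; apply: (orthonormal_basis_eq fbasis) => k; rewrite linear0l.
have := Jform_closure_span Sv (subset_closure (sequence_span_mem pair k)).
by rewrite /Jform /= Jf linear0l mulr0.
Qed.

Let Slin : linear_subspace S := sequence_span_linear pair.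
Let clSlin := closure_linear_subspace Slin.
Let Sfun v : S (0, v) -> v = 0.
Proof. by move=> Sv; exact/closure_span_single_valued/subset_closure. Qed.
Let A := relation_operator clSlin closure_span_single_valued.
Let T := relation_operator Slin Sfun.

Lemma matrix_operator_exists : exists A : operator H,
  (forall x y, dom A x -> dom A y ->
     Jform J (op A x) y = eps * Jform J x (op A y)) /\
  (forall k, dom A (f k)) /\
  (forall i j, M i j = inner H (op A (f j)) (f i)) /\
  matrix_repr_basis A f.
Proof.
have clS k : closure S (pair k) by apply/subset_closure/sequence_span_mem.
have Af k : op A (f k) = col k by exact: (relation_opE clSlin closure_span_single_valued (clS k)).
exists A; split.
  move=> x y [v Sv] [w Sw]; rewrite /A /=.
  rewrite (relation_opE clSlin closure_span_single_valued Sv).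
  rewrite (relation_opE clSlin closure_span_single_valued Sw).
  exact: (Jform_closure_span Sv Sw).
split; first by move=> k; exists (col k); exact: clS.
split; first by move=> i j; rewrite Af colE.
split.
  by rewrite /closed_operator graph_relation_operator; exact: closed_closure.
exists T; last by rewrite /is_operator_closure !graph_relation_operator.
split.
  apply/seteqP; split=> [x [v [n [c]]] /(congr1 fst)/=|_ [n [c ->]]].
    by rewrite linear_sum/= => ->; exists n, c.
  exists (\sum_(k < n) c k *: col k), n, c.
  by rewrite [RHS]surjective_pairing; congr (_, _); rewrite linear_sum.
move=> j; have -> : op T (f j) = col j.
  exact: (relation_opE Slin Sfun (sequence_span_mem pair j)).
rewrite /matrix_of (_ : (fun i => _) = (fun i => inner H (col j) (f i) *: f i)).
  exact: orthonormal_basis_expansion.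
by apply/funext => i; rewrite Af.
Qed.

End MatrixOperators.

(** * Absolutely convergent complex series *)

Section ComplexSeries.
Context (R : realType).
Implicit Types (a b u v : nat -> R[i]) (c z : R[i]).

Local Notation normc := (@Normc.normc R).
Local Notation Re := (@complex.Re R).
Local Notation Im := (@complex.Im R).

Lemma normc_ge0 z : 0 <= normc z.
Proof. by case: z => x y; exact: sqrtr_ge0. Qed.

Lemma sqr_normcE z : normc z ^+ 2 = Re z ^+ 2 + Im z ^+ 2.
Proof. by case: z => x y; rewrite sqr_sqrtr// addr_ge0 ?sqr_ge0. Qed.

Lemma ler_norm_Re z : `|Re z| <= normc z.
Proof.
by rewrite -ler_sqr ?nnegrE ?normc_ge0// sqr_normcE real_normK ?num_real// lerDl sqr_ge0.
Qed.

Lemma ler_norm_Im z : `|Im z| <= normc z.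
Proof.
by rewrite -ler_sqr ?nnegrE ?normc_ge0// sqr_normcE real_normK ?num_real// lerDr sqr_ge0.
Qed.

Lemma sqr_normcD z w : normc (z + w) ^+ 2 <= normc z ^+ 2 *+ 2 + normc w ^+ 2 *+ 2.
Proof.
case: z w => [x y] [x' y']; rewrite !sqr_normcE/=.
rewrite -subr_ge0 (_ : _ - _ = (x - x') ^+ 2 + (y - y') ^+ 2).
  by rewrite addr_ge0 ?sqr_ge0.
by ring.
Qed.

Definition summable a := cvgn (series (fun k => normc (a k))).

(** The sum of a complex series, through the limits of its real and imaginary
    parts; this reduces convergence to absolute convergence of real series. *)
Definition csum a : R[i] :=
  limn (series (fun k => Re (a k))) +i* limn (series (fun k => Im (a k))).

Lemma is_cvg_series_le_normc (h : R[i] -> R) a : (forall z, `|h z| <= normc z) ->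
  summable a -> cvgn (series (fun k => h (a k))).
Proof.
move=> hle sa; apply: normed_cvg; apply: series_le_cvg sa => n //=.
exact: normc_ge0.
Qed.

Lemma csumP c a b : summable a -> summable b ->
  csum (fun k => c * a k + b k) = c * csum a + csum b.
Proof.
move=> sa sb.
have ra := is_cvg_series_le_normc ler_norm_Re sa.
have ia := is_cvg_series_le_normc ler_norm_Im sa.
have rb := is_cvg_series_le_normc ler_norm_Re sb.
have ib := is_cvg_series_le_normc ler_norm_Im sb.
have ReP x y z w : Re ((x +i* y) * z + w) = x * Re z - y * Im z + Re w.
  by case: z w => [? ?] [? ?].
have ImP x y z w : Im ((x +i* y) * z + w) = x * Im z + y * Re z + Im w.
  by case: z w => [? ?] [? ?].
rewrite /csum; case: c => x y; simpc; congr (_ +i* _).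
  rewrite (_ : (fun k => _) = (x *: (fun k => Re (a k))) - (y *: (fun k => Im (a k)))
     + (fun k => Re (b k))); last first.
    by apply/funext => k; exact: ReP.
  apply: cvg_lim => //; rewrite !seriesD seriesN !seriesZ.
  apply: cvgD rb; apply: cvgB; first exact: (cvgZ (cvg_cst x) ra).
  exact: (cvgZ (cvg_cst y) ia).
rewrite (_ : (fun k => _) = (x *: (fun k => Im (a k))) + (y *: (fun k => Re (a k)))
     + (fun k => Im (b k))); last first.
  by apply/funext => k; exact: ImP.
apply: cvg_lim => //; rewrite !seriesD !seriesZ.
apply: cvgD ib; apply: cvgD; first exact: (cvgZ (cvg_cst x) ia).
exact: (cvgZ (cvg_cst y) ra).
Qed.

Lemma csum_conj a : summable a -> csum (fun k => (a k)^*%C) = (csum a)^*%C.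
Proof.
move=> sa; rewrite /csum/=; congr (_ +i* _).
  by congr (limn (series _)); apply/funext => k; case: (a k).
rewrite -lim_seriesN; last exact: is_cvg_series_le_normc ler_norm_Im sa.
congr (limn (series _)); apply/funext => k.
by rewrite -[RHS]/(- Im (a k)); case: (a k).
Qed.

Lemma csum_real (a : nat -> R) : csum (fun k => (a k)%:C) = (limn (series a))%:C.
Proof.
rewrite /csum/=; congr (_ +i* _).
by apply/cvg_lim => //; apply: (@series_single _ R^o _ 0%N).
Qed.

Lemma csum_single a k : (forall j, j != k -> a j = 0) -> csum a = a k.
Proof.
move=> a0; have -> : a k = Re (a k) +i* Im (a k) by case: (a k).
rewrite /csum; congr (_ +i* _); apply/cvg_lim => //.
- by apply: (@series_single _ R^o (fun j => Re (a j))) => j /a0 ->.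
- by apply: (@series_single _ R^o (fun j => Im (a j))) => j /a0 ->.
Qed.

Lemma square_summableM u v : square_summable u -> square_summable v ->
  summable (fun k => u k * (v k)^*%C).
Proof.
move=> su sv; apply: series_le_cvg (is_cvg_seriesD su sv) => n //=.
- exact: normc_ge0.
- by rewrite addr_ge0// sqr_ge0.
rewrite Normc.normcM (_ : normc (v n)^*%C = normc (v n)); last first.
  by case: (v n) => x y /=; rewrite sqrrN.
rewrite -[leRHS]/(normc (u n) ^+ 2 + normc (v n) ^+ 2).
rewrite -subr_ge0 -(@pmulr_rge0 _ 2)//.
rewrite (_ : 2 * _ = (normc (u n) - normc (v n)) ^+ 2 + normc (u n) ^+ 2 + normc (v n) ^+ 2).
  by rewrite !addr_ge0 ?sqr_ge0.
by ring.
Qed.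

Lemma square_summableP c u v : square_summable u -> square_summable v ->
  square_summable (fun k => c * u k + v k).
Proof.
move=> su sv.
have := is_cvg_seriesD (is_cvg_seriesZ (k := normc c ^+ 2 *+ 2) su)
                       (is_cvg_seriesZ (k := 2) sv).
apply: series_le_cvg => n /=.
- exact: sqr_ge0.
- by rewrite addr_ge0// mulr_ge0 ?sqr_ge0// mulrn_wge0// sqr_ge0.
rewrite -[leRHS]/(normc c ^+ 2 *+ 2 * normc (u n) ^+ 2 + 2 * normc (v n) ^+ 2).
by rewrite mulrnAl mulr_natl -exprMn -Normc.normcM; exact: sqr_normcD.
Qed.

Lemma square_summable_bounded u B :
  (forall n, \sum_(k < n) normc (u k) ^+ 2 <= B) -> square_summable u.
Proof.
move=> uB; apply: nondecreasing_is_cvgn.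
  by apply: (nondecreasing_series (P := xpredT)) => k _ _; exact: sqr_ge0.
by exists B => _ [n _ <-]; rewrite seriesEord; exact: uB.
Qed.

Lemma square_summable_sum_le u n : square_summable u ->
  \sum_(k < n) normc (u k) ^+ 2 <= limn (series (fun k => normc (u k) ^+ 2)).
Proof.
move=> su; have <- : series (fun k => normc (u k) ^+ 2) n = \sum_(k < n) normc (u k) ^+ 2.
  by rewrite seriesEord.
apply: nondecreasing_cvgn_le => //.
by apply: (nondecreasing_series (P := xpredT)) => k _ _; exact: sqr_ge0.
Qed.

End ComplexSeries.

(** * The Hilbert space of square summable sequences *)

Section LittleEll2.
Context (R : realType).
Local Notation normc := (@Normc.normc R).
Local Notation Re := (@complex.Re R).
Local Notation Im := (@complex.Im R).

(** [R[i]] is by default a module over [R]; taking the values in [R[i]^o] makes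
    the sequences a module over [R[i]]. *)
Definition ell2_pred : {pred (nat -> R[i]^o)} :=
  [pred u : nat -> R[i]^o | `[< square_summable u >]].

Lemma ell2_submod_closed : submod_closed ell2_pred.
Proof.
split=> [|c u v]; rewrite !inE.
  by apply: (@square_summable_bounded R (fun=> 0) 0) => n;
    rewrite big1// => k _; rewrite Normc.normc0 expr0n.
exact: square_summableP.
Qed.

HB.instance Definition _ :=
  GRing.isSubmodClosed.Build R[i] (nat -> R[i]^o) ell2_pred ell2_submod_closed.

Record ell2 := Ell2 { ell2_val : nat -> R[i]^o; _ : ell2_val \in ell2_pred }.

HB.instance Definition _ := [isSub for ell2_val].
HB.instance Definition _ := [Choice of ell2 by <:].
HB.instance Definition _ := [SubChoice_isSubLmodule of ell2 by <:].

Definition ell2_coord (x : ell2) (k : nat) : R[i] := ell2_val x k.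
Local Notation coord := ell2_coord.

Lemma ell2P (x : ell2) : square_summable (coord x).
Proof. by apply/asboolP; exact: (valP x). Qed.

Definition mk_ell2 (u : nat -> R[i]) (su : square_summable u) : ell2 :=
  @Ell2 (u : nat -> R[i]^o) (introT (asboolP _) su).

Lemma ell2_eq (x y : ell2) : (forall k, (coord x k) = (coord y k)) -> x = y.
Proof. by move=> xy; apply: val_inj; apply/funext. Qed.

Definition ell2_dot (x y : ell2) : R[i] := csum (fun k => (coord x k) * ((coord y k))^*%C).

Lemma ell2_summable x y : summable (fun k => coord x k * (coord y k)^*%C).
Proof. exact: (square_summableM (@ell2P x) (@ell2P y)). Qed.

Lemma ell2_dotC x y : ell2_dot x y = (ell2_dot y x)^*%C.
Proof.
rewrite /ell2_dot -csum_conj; last exact: ell2_summable.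
by congr csum; apply/funext => k; rewrite rmorphM/= conjcK mulrC.
Qed.

Lemma ell2_dotP c x y z : ell2_dot (c *: x + y) z = c * ell2_dot x z + ell2_dot y z.
Proof.
rewrite /ell2_dot -csumP; do ?exact: ell2_summable.
by congr csum; apply/funext => k; rewrite mulrA -mulrDl.
Qed.

Let dotB z : zmod_morphism (ell2_dot ^~ z).
Proof. by move=> x y /=; rewrite -scaleN1r addrC ell2_dotP mulN1r addrC. Qed.

Let dot0 z : ell2_dot 0 z = 0.
Proof. by rewrite -(subrr 0) dotB subrr. Qed.

Let dotBr z : zmod_morphism (ell2_dot z).
Proof.
by move=> x y; rewrite ell2_dotC dotB rmorphB; congr (_ - _); rewrite [RHS]ell2_dotC.
Qed.

Let dotZ z : scalable_for *%R (ell2_dot ^~ z).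
Proof. by move=> c x /=; rewrite -[c *: x]addr0 ell2_dotP dot0 addr0. Qed.

Let dotZr z : scalable_for (conjC \; *%R) (ell2_dot z).
Proof. by move=> c x; rewrite ell2_dotC dotZ rmorphM; congr (_ * _); rewrite [RHS]ell2_dotC. Qed.

HB.instance Definition _ := isBilinear.Build R[i] ell2 ell2 R[i] *%R
  (conjC \; *%R) ell2_dot dotB dotBr dotZ dotZr.

Let dot_herm x y : ell2_dot x y = (-1) ^+ false * conjC (ell2_dot y x).
Proof. by rewrite expr0 mul1r ell2_dotC. Qed.

HB.instance Definition _ :=
  isHermitianSesquilinear.Build R[i] ell2 false conjC ell2_dot dot_herm.

Lemma ell2_dotE x :
  ell2_dot x x = (limn (series (fun k => normc (coord x k) ^+ 2)))%:C.
Proof.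
rewrite -csum_real /ell2_dot; congr csum; apply/funext => k.
by rewrite -sqr_normc rmorphXn/=.
Qed.

Let dot_gt0 x : x != 0 -> 0 < ell2_dot x x.
Proof.
move=> x0; rewrite ell2_dotE ltcR lt_neqAle; apply/andP; split; last first.
  apply: le_trans (square_summable_sum_le 0 (@ell2P x)).
  by rewrite big_ord0.
apply: contra x0 => /eqP x0; apply/eqP/ell2_eq => k.
apply: Normc.eq0_normc; apply/eqP; rewrite -sqrf_eq0 eq_le sqr_ge0 andbT.
rewrite [leRHS]x0; apply: le_trans (square_summable_sum_le k.+1 (@ell2P x)).
by rewrite big_ord_recr/= lerDr sumr_ge0// => j _; exact: sqr_ge0.
Qed.

HB.instance Definition _ := isDotProduct.Build R[i] ell2 ell2_dot dot_gt0.

Definition ell2_inner : {dot ell2 for conjC} := ell2_dot.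

Let norm (x : ell2) : R[i] := sqrtC (ell2_inner x x).

Let norm_normD x y : norm (x + y) <= norm x + norm y.
Proof. exact: sqrt_dnormD. Qed.

Let norm_normZ (c : R[i]) x : norm (c *: x) = `|c| * norm x.
Proof.
by rewrite /norm dnormZ sqrtCM ?nnegrE ?dnorm_ge0 ?exprn_ge0// sqrCK.
Qed.

Let norm_eq0 x : norm x = 0 -> x = 0.
Proof. by move/eqP; rewrite sqrt_dnorm_eq0 => /eqP. Qed.

HB.instance Definition _ :=
  @Lmodule_isNormed.Build R[i] ell2 norm norm_normD norm_normZ norm_eq0.

Lemma ell2_sqr_norm (x : ell2) : `|x| ^+ 2 = ell2_inner x x.
Proof. by rewrite /Num.norm/= /norm sqrtCK. Qed.

(** Norm estimates become estimates of finite real sums, which pass to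
    coordinatewise limits. *)
Lemma ell2_norm_le (x : ell2) (e : R) : 0 <= e ->
  `|x| <= e%:C <-> forall n, \sum_(k < n) normc (coord x k) ^+ 2 <= e ^+ 2.
Proof.
move=> e0; rewrite -ler_sqr ?nnegrE ?ler0c// ell2_sqr_norm.
rewrite [ell2_inner x x]ell2_dotE -rmorphXn/= lecR; split=> [xe n|xe].
  exact: le_trans (square_summable_sum_le n (@ell2P x)) xe.
apply: limr_le; first exact: ell2P.
by near=> n; rewrite seriesEord; exact: xe.
Unshelve. all: by end_near. Qed.

End LittleEll2.

Section Ell2Hilbert.
Context (R : realType).
Local Notation normc := (@Normc.normc R).
Local Notation Re := (@complex.Re R).
Local Notation Im := (@complex.Im R).
Local Notation coord := (@ell2_coord R).
Local Notation ell2 := (ell2 R).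

Lemma ell2_coord_le (x : ell2) (e : R) k : 0 <= e -> `|x| <= e%:C -> normc (coord x k) <= e.
Proof.
move=> e0 /(ell2_norm_le _ e0)/(_ k.+1); rewrite big_ord_recr/= => xe.
rewrite -ler_sqr ?nnegrE ?normc_ge0//; apply: le_trans xe.
by rewrite lerDr sumr_ge0// => j _; exact: sqr_ge0.
Qed.

Section Completeness.
Variables (F : set_system ell2) (FF : ProperFilter F).
Hypothesis Fcauchy : cauchy F.

Let Fex (e : R) : 0 < e -> exists x, F [set y | `|x - y| <= e%:C].
Proof.
move=> e0; have /cauchyP/(_ e%:C)[|x Fx] := Fcauchy; first by rewrite ltcR.
by exists x; apply: filterS Fx => y; rewrite -ball_normE /ball_/= => /ltW.
Qed.

Let coord_cvg (h : R[i] -> R) k : (forall z w, h (z - w) = h z - h w) ->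
  (forall z, `|h z| <= normc z) -> cvg (h (coord y k) @[y --> F]).
Proof.
move=> hB hle; apply/cauchy_cvgP/cauchyP => e e0.
have [|x Fx] := Fex (e := e / 2); first by rewrite divr_gt0.
exists (h (coord x k)).
suff : F [set y | ball (h (coord x k)) e (h (coord y k))] by [].
apply: filterS Fx => y /= xy; rewrite -ball_normE /ball_ /= -hB (le_lt_trans (hle _))//.
apply: (@le_lt_trans _ _ (e / 2)); last by rewrite ltr_pdivrMr// ltr_pMr// ltr1n.
by apply: (@ell2_coord_le (x - y)) xy; rewrite divr_ge0// ltW.
Qed.

Let a k : R[i] := lim (Re (coord y k) @[y --> F]) +i* lim (Im (coord y k) @[y --> F]).

Let aRe k : Re (coord y k) @[y --> F] --> Re (a k).
Proof. by apply: coord_cvg; [case=> ? ? [? ?]|exact: ler_norm_Re]. Qed.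

Let aIm k : Im (coord y k) @[y --> F] --> Im (a k).
Proof. by apply: coord_cvg; [case=> ? ? [? ?]|exact: ler_norm_Im]. Qed.

(** The estimate is inherited from the finite sums for the members [y] of the
    filter, letting the coordinates of [y] converge. *)
Let dist_lim (x : ell2) (e : R) : 0 <= e -> F [set y | `|x - y| <= e%:C] ->
  forall n, \sum_(k < n) normc (coord x k - a k) ^+ 2 <= e ^+ 2.
Proof.
move=> e0 Fx n.
have sqrB_cvg (g : ell2 -> R) (b c : R) : g y @[y --> F] --> b ->
    (c - g y) ^+ 2 @[y --> F] --> (c - b) ^+ 2.
  move=> gb; have cgb : c - g y @[y --> F] --> c - b.
    by apply: cvgB => //; exact: cvg_cst.
  exact: (cvgM cgb cgb).
have sum_cvg : \sum_(k < n) normc (coord x k - coord y k) ^+ 2 @[y --> F] -->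
    \sum_(k < n) normc (coord x k - a k) ^+ 2.
  apply: cvg_big => [|k _]; first exact: add_continuous.
  rewrite sqr_normcE.
  rewrite (_ : (fun y => _) = (fun y => (Re (coord x k) - Re (coord y k)) ^+ 2 +
    (Im (coord x k) - Im (coord y k)) ^+ 2)); last first.
    by apply/funext => y; rewrite sqr_normcE; case: (coord x k) (coord y k) => [? ?] [? ?].
  have -> : Re (coord x k - a k) = Re (coord x k) - Re (a k).
    by case: (coord x k) (a k) => [? ?] [? ?].
  have -> : Im (coord x k - a k) = Im (coord x k) - Im (a k).
    by case: (coord x k) (a k) => [? ?] [? ?].
  exact: (cvgD (sqrB_cvg _ _ _ (@aRe k)) (sqrB_cvg _ _ _ (@aIm k))).
apply: cvgr_to_le sum_cvg _; apply: filterS Fx => y /= xy.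
exact: (ell2_norm_le (x - y) e0).1 xy n.
Qed.

(** The coordinatewise limit [a] is square summable because it is at finite
    distance from some [x1] in l2, and [dist_lim] makes the filter converge to
    it in norm. *)
Lemma ell2_cauchy_cvg : cvg F.
Proof.
have [x1 Fx1] := Fex ltr01.
have sa : square_summable a.
  have sx1a : square_summable (fun k => coord x1 k - a k).
    by apply: (@square_summable_bounded _ _ (1 ^+ 2)); exact: dist_lim Fx1.
  have := square_summableP (c := -1) sx1a (@ell2P _ x1).
  by rewrite (_ : (fun k => _) = a)//; apply/funext => k; rewrite mulN1r opprB subrK.
apply/cvg_ex; exists (mk_ell2 sa : ell2); apply/cvg_ballP => e /gt0_complex[-> e0].
have [|x Fx] := Fex (e := Re e / 3); first by rewrite divr_gt0.
have xa : `|x - mk_ell2 sa| <= (Re e / 3)%:C.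
  by apply/ell2_norm_le; [rewrite divr_ge0// ltW|apply: dist_lim => //; rewrite divr_ge0// ltW].
apply: filterS Fx => y /= xy; rewrite -ball_normE /ball_/=.
rewrite -(subrKA x) (le_lt_trans (ler_normD _ _))// distrC.
apply: (le_lt_trans (lerD xa xy)).
by rewrite -rmorphD/= ltcR; lra.
Qed.

End Completeness.

HB.instance Definition _ := Uniform_isComplete.Build ell2 ell2_cauchy_cvg.

Definition ell2_hilbert : hilbertSpace R :=
  @HilbertSpace R ell2 (@ell2_inner R) (@ell2_sqr_norm R).

Let delta_summable k : square_summable (fun j => (j == k)%:R : R[i]).
Proof.
apply/cvg_ex; exists (normc (k == k)%:R ^+ 2).
apply: (@series_single _ R^o (fun j => normc (j == k)%:R ^+ 2) k) => j /negbTE ->.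
by rewrite Normc.normc0 expr0n.
Qed.

Definition ell2_delta k : ell2_hilbert := mk_ell2 (@delta_summable k).

Lemma ell2_inner_delta (x : ell2_hilbert) k : inner ell2_hilbert x (ell2_delta k) = coord x k.
Proof.
rewrite -[LHS]/(csum _) (@csum_single _ _ k) => [|j jk].
  by rewrite /ell2_coord/= eqxx conjc1 mulr1.
by rewrite /ell2_coord/= (negbTE jk) conjc0 mulr0.
Qed.

(** The remainder of the expansion of [x] is [x] with its first [n] coordinates
    erased, so its squared norm is the tail of a convergent series. *)
Lemma ell2_delta_basis : orthonormal_basis ell2_delta.
Proof.
split=> [j k|x]; first by rewrite ell2_inner_delta /ell2_coord/= eq_sym.
exists (coord x); apply/cvgrPdist_le => e /gt0_complex[eE e0]; rewrite eE.
pose S := series (fun k => normc (coord x k) ^+ 2).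
have Scvg : S @ \oo --> limn S by exact: (@ell2P R x).
have e2 : 0 < Re e ^+ 2 by rewrite exprn_gt0.
have /cvgrPdist_le/(_ _ e2) := Scvg.
apply: filterS => n /= Sn; apply/ell2_norm_le; first exact: ltW.
move=> m.
set w := (X in coord X).
have wE k : coord w k = if (k < n)%N then 0 else coord x k.
  have -> : coord w k = coord x k - \sum_(j < n) coord x j * (k == j)%:R.
    transitivity (inner ell2_hilbert
        (x - \sum_(j < n) coord x j *: ell2_delta j) (ell2_delta k)).
      by rewrite ell2_inner_delta /w seriesEord.
    rewrite linearBl linear_sumlz/= ell2_inner_delta.
    by congr (_ - _); apply: eq_bigr => j _; rewrite linearZl_LR/= ell2_inner_delta.
  case: ifPn => [kn|kn].
    rewrite (bigD1 (Ordinal kn))//= eqxx mulr1 big1 ?addr0 ?subrr// => j jk.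
    by rewrite eq_sym -[_ == _]/(j == Ordinal kn) (negbTE jk) mulr0.
  rewrite big1 ?subr0// => j _; case: eqP => [kj|]; last by rewrite mulr0.
  by move: kn; rewrite kj ltn_ord.
clearbody w.
have wm : \sum_(k < m) normc (coord w k) ^+ 2 <= \sum_(k < n + m) normc (coord w k) ^+ 2.
  by rewrite addnC big_split_ord/= lerDl sumr_ge0// => k _; exact: sqr_ge0.
have wS : \sum_(k < n + m) normc (coord w k) ^+ 2 = S (n + m)%N - S n.
  have -> : S (n + m)%N = S n + \sum_(k < m) normc (coord x (n + k)) ^+ 2.
    by rewrite /S !seriesEord/= big_split_ord.
  rewrite addrAC subrr add0r big_split_ord/= [X in X + _]big1 ?add0r => [|k _].
    by apply: eq_bigr => k _; rewrite wE ltnNge leq_addr.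
  by rewrite wE ltn_ord Normc.normc0 expr0n.
apply: le_trans wm _; rewrite wS; apply: le_trans _ (le_trans (ler_norm _) Sn).
rewrite lerD2r.
have -> : S (n + m)%N = \sum_(k < n + m) normc (coord x k) ^+ 2.
  by rewrite /S seriesEord.
exact: (square_summable_sum_le (n + m) (@ell2P R x)).
Qed.

Let conj_summable (x : ell2) : square_summable (fun k => (coord x k)^*%C).
Proof.
rewrite /square_summable (_ : (fun k => _) = (fun k => normc (coord x k) ^+ 2)).
  exact: (@ell2P R x).
by apply/funext => k; case: (coord x k) => ? ? /=; rewrite sqrrN.
Qed.

Definition ell2_conj (x : ell2_hilbert) : ell2_hilbert := mk_ell2 (@conj_summable x).

Lemma ell2_conj_conjugation : conjugation ell2_conj.
Proof.
split=> [x|x y]; first by apply: ell2_eq => k; exact: conjcK.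
rewrite -[RHS]/((csum _)^*%C) -csum_conj; last exact: ell2_summable.
by congr csum; apply/funext => k; rewrite rmorphM.
Qed.

Lemma ell2_conj_delta k : ell2_conj (ell2_delta k) = ell2_delta k.
Proof. by apply: ell2_eq => j; exact: conjc_nat. Qed.

Lemma matrix_operator_ell2 (M : nat -> nat -> R[i]) (eps : R[i]) :
  (forall j, square_summable (fun i => M i j)) ->
  (forall i j, M i j = eps * M j i) ->
  exists A : operator ell2_hilbert,
    (forall x y, dom A x -> dom A y ->
       Jform ell2_conj (op A x) y = eps * Jform ell2_conj x (op A y)) /\
    (forall k, dom A (ell2_delta k)) /\
    (forall i j, M i j =
       inner ell2_hilbert (op A (ell2_delta j)) (ell2_delta i)) /\
    matrix_repr_basis A ell2_delta.
Proof.
move=> hcol MC; pose col j : ell2_hilbert := mk_ell2 (hcol j).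
apply: (@matrix_operator_exists R ell2_hilbert ell2_conj ell2_delta col M eps) => //.
- exact: ell2_conj_conjugation.
- exact: ell2_delta_basis.
- exact: ell2_conj_delta.
- by move=> i j; rewrite ell2_inner_delta.
Qed.

End Ell2Hilbert.

(** * Realization of a matrix with square summable columns *)

Theorem theorem3p2 (R : realType) (M : nat -> nat -> R[i])
    (hcol : forall j : nat, square_summable (fun i => M i j)) :
  ((forall i j : nat, M i j = M j i) ->
   exists H : hilbertSpace R, separable H /\
   exists (J : H -> H) (A : operator H) (f : nat -> H),
     conjugation J /\ J_symmetric J A /\
     orthonormal_basis f /\ corresponds f J /\
     (forall k : nat, dom A (f k)) /\
     (forall i j : nat, M i j = inner H (op A (f j)) (f i)) /\
     matrix_repr_basis A f) /\
  ((forall i j : nat, M i j = - M j i) ->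
   exists H : hilbertSpace R, separable H /\
   exists (J : H -> H) (A : operator H) (f : nat -> H),
     conjugation J /\ J_skew_symmetric J A /\
     orthonormal_basis f /\ corresponds f J /\
     (forall k : nat, dom A (f k)) /\
     (forall i j : nat, M i j = inner H (op A (f j)) (f i)) /\
     matrix_repr_basis A f).
Proof.
have sep := orthonormal_basis_separable (@ell2_delta_basis R).
have cor := conjugation_corresponds (@ell2_delta_basis R)
  (@ell2_conj_conjugation R) (@ell2_conj_delta R).
split=> MC; exists (ell2_hilbert R); split=> //.
  have [|A [Asym [Adom [AM Arep]]]] := @matrix_operator_ell2 R M 1 hcol.
    by move=> i j; rewrite mul1r.
  exists (@ell2_conj R), A, (@ell2_delta R).
  split; first exact: ell2_conj_conjugation.
  split; first by move=> x y Ax Ay; rewrite Asym// mul1r.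
  by split; first exact: ell2_delta_basis.
have [|A [Asym [Adom [AM Arep]]]] := @matrix_operator_ell2 R M (-1) hcol.
  by move=> i j; rewrite mulN1r.
exists (@ell2_conj R), A, (@ell2_delta R).
split; first exact: ell2_conj_conjugation.
split; first by move=> x y Ax Ay; rewrite Asym// mulN1r.
by split; first exact: ell2_delta_basis.
Qed.
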